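(* If $(X,d_X)$ is a totally bounded metric space, then the persistence modules $\mathrm{H}(\mathbb{R}\mathrm{ips}(X))$ and $\mathrm{H}(\check{\mathbb{C}}\mathrm{ech}(X))$ are q-tame.
   Context: Fix a field $\mathbf{k}$; $\mathrm{H}$ denotes (total) simplicial homology with coefficients in $\mathbf{k}$. A persistence module $\mathbb{V}$ is a family of $\mathbf{k}$-vector spaces $(V_a)_{a\in\mathbf{R}}$ with linear maps $v_a^b:V_a\to V_b$ for $a\le b$ such that $v_a^a=\mathrm{id}$ and $v_b^c\circ v_a^b=v_a^c$ for $a\le b\le c$. It is q-tame if $\mathrm{rank}(v_a^b)<\infty$ whenever $a<b$. A metric space $(X,d_X)$ is totally bounded if for every $\varepsilon>0$ there is a finite subset $F\subseteq X$ such that every $x\in X$ has some $f\in F$ with $d_X(x,f)<\varepsilon$. For $a\in\mathbf{R}$, the Vietoris--Rips complex $\mathrm{Rips}(X,a)$ is the simplicial complex whose simplices are the nonempty finite subsets $\{x_0,\dots,x_k\}\subseteq X$ with $d_X(x_i,x_j)\le a$ for all $i,j$ (including $i=j$). The intrinsic Čech complex $\check{\mathrm{C}}\mathrm{ech}(X,a)$ is the simplicial complex whose simplices are the nonempty finite subsets $\{x_0,\dots,x_k\}\subseteq X$ with $\bigcap_{i=0}^k B(x_i,a)\neq\emptyset$, where $B(x,a)=\{x'\in X: d_X(x,x')\le a\}$. Both complexes are empty for $a<0$. $\mathrm{H}(\mathbb{R}\mathrm{ips}(X))$ and $\mathrm{H}(\check{\mathbb{C}}\mathrm{ech}(X))$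 are the persistence modules $(\mathrm{H}(\mathrm{Rips}(X,a)))_{a\in\mathbf{R}}$ and $(\mathrm{H}(\check{\mathrm{C}}\mathrm{ech}(X,a)))_{a\in\mathbf{R}}$ with maps induced by inclusions. *)

(* Defs.v *)
From HB Require Import structures.
From mathcomp Require Import all_boot all_order all_algebra.
From mathcomp Require Import finmap generic_quotient ring_quotient freeg.
From mathcomp Require Import all_classical all_reals all_analysis.

Set Implicit Arguments.
Unset Strict Implicit.
Unset Printing Implicit Defensive.

Import Order.TTheory GRing.Theory Num.Theory.
Local Open Scope classical_set_scope.
Local Open Scope quotient_scope.
Local Open Scope ring_scope.

Section LinearAlgebra.
Context {k : fieldType}.

Record submod (V : lmodType k) := Submod {
  submod_pred : {pred V};
  submod_predP : submod_closed submod_pred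
}.

HB.instance Definition _ (V : lmodType k) (S : submod V) :=
  GRing.isSubmodClosed.Build k V (submod_pred S) (submod_predP S).

Definition in_submod (V : lmodType k) (S : submod V) (v : V) : Prop :=
  v \in submod_pred S.

Lemma submod_setP (V : lmodType k) (P : set V) (P0 : P 0)
    (PD : forall a u v, P u -> P v -> P (a *: u + v)) :
  submod_closed (mem P).
Proof.
by split=> [|a u v]; rewrite !inE//; exact: PD.
Qed.

Definition submod_set (V : lmodType k) (P : set V) (P0 : P 0)
    (PD : forall a u v, P u -> P v -> P (a *: u + v)) : submod V :=
  Submod (submod_setP P0 PD).

Lemma submod_setE (V : lmodType k) (P : set V) P0 PD v :
  in_submod (@submod_set V P P0 PD) v <-> P v.
Proof. by rewrite /in_submod /submod_set/= -topredE/= inE. Qed.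

Lemma in_submod0 (V : lmodType k) (S : submod V) : in_submod S 0.
Proof. exact: rpred0. Qed.

Lemma in_submodP (V : lmodType k) (S : submod V) a u v :
  in_submod S u -> in_submod S v -> in_submod S (a *: u + v).
Proof. by move=> Su Sv; apply: rpredD => //; exact: rpredZ. Qed.

Program Definition span (V : lmodType k) (A : set V) : submod V :=
  @submod_set V
    [set v | forall S : submod V, (forall u, A u -> in_submod S u) ->
                                  in_submod S v] _ _.
Next Obligation. by move=> V A S _; exact: in_submod0. Qed.
Next Obligation.
by move=> V A a u v Su Sv S AS; apply: in_submodP; [exact: Su|exact: Sv].
Qed.

Lemma span_sub (V : lmodType k) (A : set V) v : A v -> in_submod (span A) v.
Proof. by move=> Av; apply/submod_setE => S; exact. Qed.

Lemma span_min (V : lmodType k) (A : set V) (S : submod V) v :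
  (forall u, A u -> in_submod S u) -> in_submod (span A) v -> in_submod S v.
Proof. by move=> AS /submod_setE; exact. Qed.

Program Definition image_submod (V W : lmodType k) (f : {linear V -> W})
    (S : submod V) : submod W :=
  @submod_set W [set w | exists2 v, in_submod S v & w = f v] _ _.
Next Obligation.
by move=> V W f S; exists 0; rewrite ?linear0//; exact: in_submod0.
Qed.
Next Obligation.
move=> V W f S a _ _ [u Su ->] [v Sv ->]; exists (a *: u + v).
  exact: in_submodP.
by rewrite linearP.
Qed.

Program Definition preimage_submod (V W : lmodType k) (f : {linear V -> W})
    (S : submod W) : submod V :=
  @submod_set V [set v | in_submod S (f v)] _ _.
Next Obligation. by move=> V W f S /=; rewrite linear0; exact: in_submod0. Qed.
Next Obligation.
by move=> V W f S a u v /= Su Sv; rewrite linearP; exact: in_submodP.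
Qed.

Lemma span_linear (V W : lmodType k) (f : {linear V -> W}) (A : set V)
    (S : submod W) v :
  (forall u, A u -> in_submod S (f u)) -> in_submod (span A) v ->
  in_submod S (f v).
Proof.
move=> AS Av.
suff /submod_setE : in_submod (preimage_submod f S) v by [].
by apply: span_min Av => u Au; apply/submod_setE; exact: AS.
Qed.

Section Subspace.
Variables (V : lmodType k) (S : submod V).

Definition subspace := {v : V | v \in submod_pred S}.

HB.instance Definition _ := SubChoice.on subspace.
HB.instance Definition _ := [SubChoice_isSubLmodule of subspace by <:].

End Subspace.

Lemma submod_incl_subproof (V : lmodType k) (S T : submod V)
    (ST : forall v, in_submod S v -> in_submod T v) (x : subspace S) :
  val x \in submod_pred T.
Proof. exact/ST/valP. Qed.

Definition submod_incl (V : lmodType k) (S T : submod V)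
    (ST : forall v, in_submod S v -> in_submod T v) (x : subspace S) :
  subspace T := exist _ (val x) (submod_incl_subproof ST x).

Lemma submod_incl_is_linear (V : lmodType k) (S T : submod V)
    (ST : forall v, in_submod S v -> in_submod T v) :
  linear (submod_incl ST).
Proof.
move=> a x y; apply: val_inj; rewrite (linearP (val : subspace T -> V)).
exact: (linearP (val : subspace S -> V)).
Qed.

HB.instance Definition _ (V : lmodType k) (S T : submod V) ST :=
  GRing.isLinear.Build k (subspace S) (subspace T) _ (submod_incl ST)
    (@submod_incl_is_linear V S T ST).

Section Quotient.
Variables (V : lmodType k) (S : submod V).

Definition quotmod := Quotient.quot (submod_pred S).

HB.instance Definition _ := Choice.on quotmod.
HB.instance Definition _ := EqQuotient.on quotmod.
HB.instance Definition _ := GRing.Zmodule.on quotmod.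

Definition quot_proj (v : V) : quotmod := \pi_quotmod v.

Lemma quot_projP u v : in_submod S (u - v) <-> quot_proj u = quot_proj v.
Proof.
rewrite /in_submod /quot_proj; split=> [h|/eqP].
  by apply/eqP; rewrite -Quotient.idealrBE.
by rewrite -Quotient.idealrBE.
Qed.

Lemma quot_proj_repr x : quot_proj (repr x) = x.
Proof. exact: reprK. Qed.

Lemma quot_projB : zmod_morphism quot_proj.
Proof. by move=> u v; rewrite /quot_proj !piE. Qed.

HB.instance Definition _ :=
  GRing.isZmodMorphism.Build V quotmod quot_proj quot_projB.

Definition quot_scale (a : k) (x : quotmod) : quotmod :=
  quot_proj (a *: repr x).

Lemma quot_scaleE a v : quot_scale a (quot_proj v) = quot_proj (a *: v).
Proof.
apply/quot_projP; rewrite -scalerBr; apply: rpredZ.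
by apply/quot_projP; rewrite quot_proj_repr.
Qed.

Lemma quot_scaleA a b x : quot_scale a (quot_scale b x) = quot_scale (a * b) x.
Proof. by rewrite -[x]quot_proj_repr !quot_scaleE scalerA. Qed.

Lemma quot_scale1 : left_id 1 quot_scale.
Proof. by move=> x; rewrite -[x]quot_proj_repr !quot_scaleE scale1r. Qed.

Lemma quot_scaleDr : right_distributive quot_scale +%R.
Proof.
move=> a x y; rewrite -[x]quot_proj_repr -[y]quot_proj_repr.
by rewrite -raddfD !quot_scaleE -raddfD scalerDr.
Qed.

Lemma quot_scaleDl x : {morph quot_scale^~ x : a b / a + b}.
Proof.
move=> a b; rewrite -[x]quot_proj_repr.
by rewrite !quot_scaleE -raddfD scalerDl.
Qed.

HB.instance Definition _ := GRing.Zmodule_isLmodule.Build k quotmod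
  quot_scaleA quot_scale1 quot_scaleDr quot_scaleDl.

Lemma quot_projZ : scalable quot_proj.
Proof. by move=> a v; rewrite -quot_scaleE. Qed.

HB.instance Definition _ :=
  GRing.isScalable.Build k V quotmod _ quot_proj quot_projZ.

Definition quot_lift (W : lmodType k) (f : {linear V -> W})
    (fS : forall v, in_submod S v -> f v = 0) (x : quotmod) : W :=
  f (repr x).

Lemma quot_liftE (W : lmodType k) (f : {linear V -> W}) fS v :
  @quot_lift W f fS (quot_proj v) = f v.
Proof.
apply/eqP; rewrite -subr_eq0 -linearB; apply/eqP/fS/quot_projP.
exact: quot_proj_repr.
Qed.

Lemma quot_lift_is_linear (W : lmodType k) (f : {linear V -> W}) fS :
  linear (@quot_lift W f fS).
Proof.
move=> a x y; rewrite -[x]quot_proj_repr -[y]quot_proj_repr.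
by rewrite -linearP !quot_liftE linearP.
Qed.

HB.instance Definition _ (W : lmodType k) (f : {linear V -> W}) fS :=
  GRing.isLinear.Build k quotmod W _ (@quot_lift W f fS)
    (@quot_lift_is_linear W f fS).

End Quotient.

(* The image of f is spanned by finitely many vectors. *)
Definition finite_rank (U W : lmodType k) (f : {linear U -> W}) : Prop :=
  exists n (u : 'I_n -> U), forall x : U, exists a : 'I_n -> k,
    f x = \sum_(i < n) a i *: f (u i).

End LinearAlgebra.

Lemma fglift_is_linear (k : fieldType) (K : choiceType) (W : lmodType k)
    (f : K -> W) : linear (fglift f : {freeg K / k} -> W).
Proof.
pose F : {freeg K / k} -> W := fglift f.
have FB u v : F (u - v) = F u - F v by exact: lift_is_additive.
have F0 : F 0 = 0 by rewrite -(subrr (0 : {freeg K / k})) FB subrr.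
have FD u v : F (u + v) = F u + F v.
  by rewrite -{1}[v]opprK -[- v]sub0r !FB F0 sub0r opprK.
move=> a u v; rewrite -[LHS]/(F _) -![fglift f _]/(F _) FD; congr (_ + _).
have FS (s : seq K) (g : K -> {freeg K / k}) :
    F (\sum_(z <- s) g z) = \sum_(z <- s) F (g z).
  by rewrite (big_morph F FD F0).
have ZU c z : a *: << c *g z >> = << a * c *g z >> :> {freeg K / k}.
  by apply/eqP/freeg_eqP => y; rewrite coeffZ !coeffU mulrA.
rewrite -(freeg_sumE u) scaler_sumr !FS scaler_sumr.
by apply: eq_bigr => z _; rewrite ZU /F !liftU scalerA.
Qed.

HB.instance Definition _ (k : fieldType) (K : choiceType) (W : lmodType k)
    (f : K -> W) :=
  GRing.isLinear.Build k {freeg K / k} W _ (fglift f) (fglift_is_linear f).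

Section OrientedChains.
Variables (k : fieldType) (X : choiceType).
Local Notation free := {freeg (seq X) / k}.

(* Oriented chains on the full simplex with vertex set X: an ordered simplex
   changes sign when two adjacent vertices are exchanged and is 0 when a vertex
   is repeated, which is what [v_(sigma 0), ..., v_(sigma n)] =
   sgn(sigma) [v_0, ..., v_n] amounts to in every characteristic. *)
Definition orientation_rel : set free :=
  [set r | (exists s1 x y s2, r = << s1 ++ x :: y :: s2 >>
                                  + << s1 ++ y :: x :: s2 >>)
        \/ (exists s1 x s2, r = << s1 ++ x :: x :: s2 >>)].

(* The empty sequence spans no simplex; killing it makes the boundary of a
   vertex vanish, so that homology is not reduced. *)
Definition chain_rel : submod free :=
  span (orientation_rel `|` [set << [::] >>]).

Definition chains := quotmod chain_rel.
HB.instance Definition _ := GRing.Lmodule.on chains.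

Definition osimplex (s : seq X) : chains := quot_proj chain_rel << s >>.

Definition seq_boundary (s : seq X) : free :=
  \sum_(i < size s) (-1) ^+ i *: << take i s ++ drop i.+1 s >>.

Definition free_boundary : {linear free -> free} := fglift seq_boundary.

Definition free_cons (x : X) : {linear free -> free} :=
  fglift (fun s => << x :: s >> : free).

Lemma free_ind (P : free -> Prop) (P0 : P 0)
    (PD : forall a s u, P u -> P (a *: << s >> + u)) u : P u.
Proof.
rewrite -(freeg_sumE u); elim: (dom u) => [|s l IH]; first by rewrite big_nil.
rewrite big_cons.
suff -> : << coeff s u *g s >> = coeff s u *: << s >> :> free by exact: PD.
by apply/eqP/freeg_eqP => y; rewrite coeffZ !coeffU mul1r.
Qed.

Lemma fglift1 (W : lmodType k) (f : seq X -> W) s :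
  fglift f (<< s >> : free) = f s.
Proof. by rewrite liftU scale1r. Qed.

Lemma free_boundary_nil : free_boundary << [::] >> = 0.
Proof. by rewrite [LHS]fglift1 /seq_boundary big_ord0. Qed.

Lemma free_boundary_cons x u :
  free_boundary (free_cons x u) = u - free_cons x (free_boundary u).
Proof.
elim/free_ind: u => [|a s u IH]; first by rewrite !linear0 addr0.
rewrite !(linearD, linearZZ) IH /= !fglift1 /seq_boundary /= big_ord_recl /=.
rewrite expr0 scale1r drop0 addrACA -scalerDr; congr (_ *: (_ + _) + _).
rewrite linear_sum -sumrN; apply: eq_bigr => i _.
by rewrite linearZ /= fglift1 exprS mulN1r scaleNr.
Qed.

Lemma free_cons_seq x s : free_cons x << s >> = << x :: s >>.
Proof. exact: fglift1. Qed.

Lemma free_boundary_seq_cons x s :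
  free_boundary << x :: s >> = << s >> - free_cons x (free_boundary << s >>).
Proof. by rewrite -free_boundary_cons free_cons_seq. Qed.

Lemma free_boundary_boundary u : free_boundary (free_boundary u) = 0.
Proof.
elim/free_ind: u => [|a s u IH]; first by rewrite !linear0.
rewrite !(linearD, linearZZ) IH addr0.
suff -> : free_boundary (free_boundary << s >>) = 0 by rewrite scaler0.
elim: s {u IH} => [|x s IH]; first by rewrite free_boundary_nil linear0.
rewrite free_boundary_seq_cons linearB free_boundary_cons IH linear0.
by rewrite subr0 subrr.
Qed.

Lemma free_cons_rel x u :
  in_submod (span orientation_rel) u ->
  in_submod (span orientation_rel) (free_cons x u).
Proof.
apply: span_linear => {}u ru; apply: span_sub.
case: ru => [[s1 [y [z [s2 ->]]]]|[s1 [y [s2 ->]]]].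
  by left; exists (x :: s1), y, z, s2; rewrite linearD !free_cons_seq.
by right; exists (x :: s1), y, s2; rewrite free_cons_seq.
Qed.

Lemma seq_boundary_swap s1 x y s2 :
  in_submod (span orientation_rel)
    (free_boundary (<< s1 ++ x :: y :: s2 >> + << s1 ++ y :: x :: s2 >>)).
Proof.
elim: s1 => [|z s1 IH] /=.
  rewrite -!free_cons_seq linearD !free_boundary_cons.
  set u := free_boundary << s2 >>.
  pose T := [set u | in_submod (span orientation_rel)
               (free_cons x (free_cons y u) + free_cons y (free_cons x u))].
  have : T u.
    elim/free_ind: u => [|a s u IH].
      by rewrite /T/= !linear0 addr0; exact: in_submod0.
    rewrite /T/= in IH *; rewrite !(linearD, linearZZ) addrACA -scalerDr.
    apply: in_submodP => //; apply: span_sub; left.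
    by exists [::], x, y, s; rewrite !free_cons_seq.
  have E (a b c d : free) : a - (b - c) + (b - (a - d)) = c + d.
    by rewrite !opprB addrACA [c - b + _]addrACA -opprD addrCA (addrC b) subrr addr0.
  by rewrite !(linearB (free_cons _)) E.
rewrite linearD !free_boundary_seq_cons addrACA -opprD -linearD -linearD.
rewrite -scaleN1r addrC; apply: in_submodP; first exact: free_cons_rel.
by apply: span_sub; left; exists s1, x, y, s2.
Qed.

Lemma seq_boundary_repeat s1 x s2 :
  in_submod (span orientation_rel) (free_boundary << s1 ++ x :: x :: s2 >>).
Proof.
elim: s1 => [|z s1 IH] /=.
  rewrite -!free_cons_seq !free_boundary_cons.
  set u := free_boundary << s2 >>.
  rewrite (linearB (free_cons x)) opprB addrCA subrr addr0.
  elim/free_ind: u => [|a s u IH].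
    by rewrite !linear0; exact: in_submod0.
  rewrite !(linearD, linearZZ); apply: in_submodP => //.
  by apply: span_sub; right; exists [::], x, s; rewrite !free_cons_seq.
rewrite free_boundary_seq_cons -scaleN1r addrC.
apply: in_submodP; first exact: free_cons_rel.
by apply: span_sub; right; exists s1, x, s2.
Qed.

Lemma free_boundary_rel u :
  in_submod chain_rel u -> in_submod chain_rel (free_boundary u).
Proof.
apply: span_linear => {}u ru.
have sub v : in_submod (span orientation_rel) v -> in_submod chain_rel v.
  by apply: span_min => w rw; apply: span_sub; left.
case: ru => [[[s1 [x [y [s2 ->]]]]|[s1 [x [s2 ->]]]]|/= ->].
- exact/sub/seq_boundary_swap.
- exact/sub/seq_boundary_repeat.
- by rewrite free_boundary_nil; exact: in_submod0.
Qed.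

Lemma boundary_subproof u :
  in_submod chain_rel u -> quot_proj chain_rel (free_boundary u) = 0.
Proof.
move=> /free_boundary_rel ru; rewrite -(linear0 (quot_proj chain_rel)).
by apply/quot_projP; rewrite subr0.
Qed.

Definition boundary : {linear chains -> chains} :=
  @quot_lift _ _ chain_rel chains (quot_proj chain_rel \o free_boundary)
    boundary_subproof.

Lemma boundaryE u :
  boundary (quot_proj chain_rel u) = quot_proj chain_rel (free_boundary u).
Proof. exact: quot_liftE. Qed.

Lemma boundary_boundary c : boundary (boundary c) = 0.
Proof.
rewrite -[c]quot_proj_repr !boundaryE free_boundary_boundary.
exact: linear0.
Qed.

End OrientedChains.

Record simplicial_complex (X : choiceType) := SimplicialComplex {
  simplices : set {fset X};
  simplices_neq0 : forall s, simplices s -> s != fset0;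
  simplices_face : forall s t, simplices s -> (t `<=` s)%fset -> t != fset0 ->
    simplices t
}.

Section Homology.
Variables (k : fieldType) (X : choiceType).
Implicit Types K L : simplicial_complex X.

Definition subcomplex K L := simplices K `<=` simplices L.

(* C(K) is the direct sum of the C_n(K) over all n, and the boundary map is
   homogeneous, so the quotient of its kernel by its image is the total
   homology, the direct sum of the H_n(K) over all n. *)
Definition complex_chains K : submod (chains k X) :=
  span [set c | exists2 s : seq X,
                  simplices K [fset x | x in s]%fset & c = osimplex k s].

Program Definition cycles K : submod (chains k X) :=
  @submod_set _ _
    [set c | in_submod (complex_chains K) c /\ boundary k X c = 0] _ _.
Next Obligation. by move=> K; split; [exact: in_submod0|exact: linear0]. Qed.
Next Obligation.
move=> K a u v [Ku du] [Kv dv]; split; first exact: in_submodP.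
by rewrite linearD linearZZ du dv scaler0 addr0.
Qed.

Definition boundaries K : submod (chains k X) :=
  image_submod (boundary k X) (complex_chains K).

Definition cycle_inj K : {linear subspace (cycles K) -> chains k X} := val.

Definition homology K : lmodType k :=
  quotmod (preimage_submod (cycle_inj K) (boundaries K)).

Lemma complex_chains_boundary K c :
  in_submod (complex_chains K) c -> in_submod (complex_chains K) (boundary k X c).
Proof.
apply: span_linear => {}c [s Ks ->].
rewrite boundaryE [free_boundary _ _ _]fglift1 /seq_boundary linear_sum.
apply: rpred_sum => i _; rewrite linearZZ; apply: rpredZ.
set t := take i s ++ drop i.+1 s.
change (in_submod (complex_chains K) (osimplex k t)).
have [->|t0] := eqVneq t [::].
  suff -> : osimplex k [::] = 0 :> chains k X by exact: in_submod0.
  rewrite -(linear0 (quot_proj (chain_rel k X))); apply/quot_projP.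
  by rewrite subr0; apply: span_sub; right.
apply: span_sub; exists t => //; apply: (simplices_face Ks).
  apply/fsubsetP => x; rewrite !inE => /orP[/mem_take//|/mem_drop//].
by case: t t0 => // x t' _; apply/fset0Pn; exists x; rewrite !inE eqxx.
Qed.

Lemma boundaries_sub_cycles K c :
  in_submod (boundaries K) c -> in_submod (cycles K) c.
Proof.
move=> /submod_setE[b Kb ->]; apply/submod_setE; split.
  exact: complex_chains_boundary.
exact: boundary_boundary.
Qed.

Lemma complex_chainsS K L (KL : subcomplex K L) c :
  in_submod (complex_chains K) c -> in_submod (complex_chains L) c.
Proof.
apply: span_min => {}c [s Ks ->]; apply: span_sub; exists s => //.
exact: KL.
Qed.

Lemma cyclesS K L (KL : subcomplex K L) c :
  in_submod (cycles K) c -> in_submod (cycles L) c.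
Proof.
move=> /submod_setE[Kc dc]; apply/submod_setE; split => //.
exact: complex_chainsS Kc.
Qed.

Lemma boundariesS K L (KL : subcomplex K L) c :
  in_submod (boundaries K) c -> in_submod (boundaries L) c.
Proof.
move=> /submod_setE[b Kb ->]; apply/submod_setE; exists b => //.
exact: complex_chainsS Kb.
Qed.

Definition homology_class K (z : subspace (cycles K)) : homology K :=
  quot_proj _ z.

Definition cycles_incl K L (KL : subcomplex K L) :
  {linear subspace (cycles K) -> subspace (cycles L)} :=
  submod_incl (cyclesS KL).

Lemma homology_map_subproof K L (KL : subcomplex K L) (z : subspace (cycles K)) :
  in_submod (preimage_submod (cycle_inj K) (boundaries K)) z ->
  quot_proj (preimage_submod (cycle_inj L) (boundaries L)) (cycles_incl KL z) = 0.
Proof.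
move=> /submod_setE Kz; rewrite -(linear0 (quot_proj _)).
apply/quot_projP; rewrite subr0; apply/submod_setE.
exact: (boundariesS KL).
Qed.

Definition homology_map K L (KL : subcomplex K L) :
  {linear homology K -> homology L} :=
  @quot_lift _ _ _ (homology L) (quot_proj _ \o cycles_incl KL)
    (homology_map_subproof KL).

Lemma homology_mapE K L (KL : subcomplex K L) (z : subspace (cycles K)) :
  homology_map KL (homology_class z) = homology_class (cycles_incl KL z).
Proof. exact: quot_liftE. Qed.

Lemma homology_map_id K (KK : subcomplex K K) h : homology_map KK h = h.
Proof.
rewrite -[h]quot_proj_repr [LHS]homology_mapE; congr homology_class.
exact: val_inj.
Qed.

Lemma homology_map_comp K L M (KL : subcomplex K L) (LM : subcomplex L M)
    (KM : subcomplex K M) h :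
  homology_map LM (homology_map KL h) = homology_map KM h.
Proof.
rewrite -[h]quot_proj_repr -/(homology_class (repr h)); move: (repr h) => z.
rewrite (homology_mapE KL z) (homology_mapE LM) (homology_mapE KM z).
by congr homology_class; exact: val_inj.
Qed.

End Homology.

Record persistence_module (k : fieldType) (R : realType) := PersistenceModule {
  pm_space : R -> lmodType k;
  pm_map : forall a b, a <= b -> {linear pm_space a -> pm_space b};
  pm_map_id : forall a (aa : a <= a) v, pm_map aa v = v;
  pm_map_comp : forall a b c (ab : a <= b) (bc : b <= c) (ac : a <= c) v,
    pm_map bc (pm_map ab v) = pm_map ac v
}.

Definition q_tame (k : fieldType) (R : realType) (V : persistence_module k R) :=
  forall a b (ab : a < b), finite_rank (pm_map V (ltW ab)).

Record filtered_complex (X : choiceType) (R : realType) := FilteredComplex {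
  fc_complex : R -> simplicial_complex X;
  fc_mono : forall a b, a <= b -> subcomplex (fc_complex a) (fc_complex b)
}.

Arguments fc_mono {X R} f {a b} ab _ _.

Definition persistent_homology (k : fieldType) (X : choiceType) (R : realType)
    (F : filtered_complex X R) : persistence_module k R :=
  @PersistenceModule k R (fun a => homology k (fc_complex F a))
    (fun a b ab => homology_map k (fc_mono F ab))
    (fun a aa => homology_map_id (fc_mono F aa))
    (fun a b c ab bc ac =>
       homology_map_comp (fc_mono F ab) (fc_mono F bc) (fc_mono F ac)).

Section Metric.
Variables (R : realType) (X : metricType R).

Definition is_totally_bounded : Prop :=
  forall e : R, 0 < e ->
    exists F : {fset X}, forall x : X, exists2 f, f \in F & mdist x f < e.

Definition rips_simplices (a : R) : set {fset X} :=
  [set s | s != fset0 /\ forall x y, x \in s -> y \in s -> mdist x y <= a].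

Definition cball (x : X) (a : R) : set X := [set x' | mdist x x' <= a].

Definition cech_simplices (a : R) : set {fset X} :=
  [set s | s != fset0 /\ \bigcap_(x in [set` s]) cball x a !=set0].

Lemma rips_face a s t : rips_simplices a s -> (t `<=` s)%fset -> t != fset0 ->
  rips_simplices a t.
Proof.
move=> [_ sa] /fsubsetP ts t0; split=> // x y tx ty.
by apply: sa; exact: ts.
Qed.

Lemma cech_face a s t : cech_simplices a s -> (t `<=` s)%fset -> t != fset0 ->
  cech_simplices a t.
Proof.
move=> [_ [y sa]] /fsubsetP ts t0; split=> //; exists y => x tx.
by apply: sa; exact: ts.
Qed.

Definition rips (a : R) : simplicial_complex X :=
  @SimplicialComplex X (rips_simplices a) (fun s => @proj1 _ _) (@rips_face a).

Definition cech (a : R) : simplicial_complex X :=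
  @SimplicialComplex X (cech_simplices a) (fun s => @proj1 _ _) (@cech_face a).

Lemma ripsS a b : a <= b -> subcomplex (rips a) (rips b).
Proof.
move=> ab s [s0 sa]; split=> // x y sx sy; exact: le_trans (sa _ _ sx sy) ab.
Qed.

Lemma cechS a b : a <= b -> subcomplex (cech a) (cech b).
Proof.
move=> ab s [s0 [y sa]]; split=> //; exists y => x sx.
exact: le_trans (sa _ sx) ab.
Qed.

Definition rips_filtration : filtered_complex X R :=
  @FilteredComplex X R rips ripsS.

Definition cech_filtration : filtered_complex X R :=
  @FilteredComplex X R cech cechS.

End Metric.

(* Main.v *)
From mathcomp Require Import all_boot all_order all_algebra.
From mathcomp Require Import finmap freeg.
From mathcomp Require Import all_classical all_reals all_analysis.
Require Import Defs.

Set Implicit Arguments.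
Unset Strict Implicit.
Unset Printing Implicit Defensive.

Import Order.TTheory GRing.Theory Num.Theory.
Local Open Scope classical_set_scope.
Local Open Scope ring_scope.

(** The reason for q-tameness is that for [a < b] the inclusion of the complex at
    scale [a] into the complex at scale [b] is homotopic to a simplicial map that
    factors through a finite complex.  Total boundedness gives a finite net [F]
    and a map [f] moving every point by less than a prescribed [e] to a point of
    [F].  If [e] is small compared with [b - a], then [f] is contiguous to the
    inclusion: for every simplex [s] at scale [a], the union of [s] and [f s] is
    a simplex at scale [b] ([rips_contiguous], [cech_contiguous]).  So a cycle
    [z] at scale [a] is homologous, at scale [b], to its image under [f], and
    oriented chains with vertices in the finite set [F] form a space of finite
    dimension ([finite_rank_homology_map]).

    The homotopy is the prism operator, which sends [[v_0, ..., v_n]] to the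
    alternating sum of the [[v_0, ..., v_i, f v_i, ..., f v_n]].  On ordered
    sequences it satisfies the homotopy formula exactly ([prism_homotopy]), but
    it does not respect the orientation relations, so it does not descend to
    oriented chains.  This is repaired with a total order on the vertices: a cycle
    [z] is the class of a combination [u] of strictly increasing sequences, the
    boundary of [u] is again such a combination, and it is zero as an oriented
    chain because [z] is a cycle.  Distinct nonempty increasing sequences being
    linearly independent among oriented chains ([chain_rel_sorted]), the boundary
    of [u] vanishes up to a multiple of the empty sequence before any orientation
    relation is imposed, and the homotopy formula applied to [u] shows that [z]
    and its image under [f] differ by a boundary ([cycle_homologous]).

    The linear independence comes from sorting a sequence with the sign of the
    sorting permutation, a repetition giving [0] ([normalize]): this is insertion
    sort, and it annihilates the orientation relations because inserting [x] and
    inserting [y] anticommute ([insertC]). *)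

(** * Spans and maps of finite rank *)

Section Submodules.
Context {k : fieldType}.

Lemma span_ind (V : lmodType k) (A P : set V) :
  P 0 -> (forall a u v, P u -> P v -> P (a *: u + v)) ->
  (forall u, A u -> P u) -> forall v, in_submod (span A) v -> P v.
Proof.
move=> P0 PD AP v Av; suff /submod_setE : in_submod (submod_set P0 PD) v by [].
by apply: span_min Av => u Au; apply/submod_setE; exact: AP.
Qed.

Lemma in_submodB (V : lmodType k) (S : submod V) u v :
  in_submod S u -> in_submod S v -> in_submod S (u - v).
Proof. by move=> Su Sv; rewrite -scaleN1r addrC; exact: in_submodP. Qed.

Lemma in_submodZ (V : lmodType k) (S : submod V) a u :
  in_submod S u -> in_submod S (a *: u).
Proof. by move=> Su; rewrite -[_ *: _]addr0; exact/in_submodP/in_submod0. Qed.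

End Submodules.

Section FiniteRank.
Context {k : fieldType}.

Lemma span_finite (V : lmodType k) n (w : 'I_n -> V) v :
  in_submod (span (range w)) v ->
  exists a : 'I_n -> k, v = \sum_(i < n) a i *: w i.
Proof.
apply: (span_ind (P := fun v => exists a : 'I_n -> k,
    v = \sum_(i < n) a i *: w i)) => [|c u u' [a ->] [b ->]|_ [i _ <-]].
- by exists (fun=> 0); rewrite big1// => i _; rewrite scale0r.
- exists (fun i => c * a i + b i); rewrite scaler_sumr -big_split.
  by apply: eq_bigr => i _; rewrite scalerDl scalerA.
- exists (fun j => (j == i)%:R).
  rewrite (bigD1 i)//= eqxx scale1r big1 ?addr0// => j /negbTE ->.
  by rewrite scale0r.
Qed.

(** The vectors [w i] need not be values of [f].  The coefficient rows of the
    values of [f] form a subspace of a space of row vectors; a matrix of maximal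
    rank among those with rows in it spans it, and its rows belong to values of
    [f] that span the image. *)
Lemma finite_rank_codomain (U W : lmodType k) (f : {linear U -> W}) n
    (w : 'I_n -> W) :
  (forall x, exists a : 'I_n -> k, f x = \sum_(i < n) a i *: w i) ->
  finite_rank f.
Proof.
move=> fw.
pose comb (a : 'rV[k]_n) := \sum_(i < n) a 0 i *: w i.
have combP c a b : comb (c *: a + b) = c *: comb a + comb b.
  rewrite /comb scaler_sumr -big_split; apply: eq_bigr => i _.
  by rewrite !mxE scalerDl scalerA.
have comb0 : comb 0 = 0.
  by rewrite /comb big1// => i _; rewrite mxE scale0r.
have comb_sum m (c : 'I_m -> k) (a : 'I_m -> 'rV_n) :
    comb (\sum_(i < m) c i *: a i) = \sum_(i < m) c i *: comb (a i).
  by elim/big_rec2: _ => [|i x y _ <-]; rewrite ?comb0 ?combP.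
pose coefs (a : 'rV[k]_n) := exists x, f x = comb a.
pose realized r := exists m (M : 'M[k]_(m, n)),
  (forall i, coefs (row i M)) /\ \rank M = r.
have ex_r : exists r, `[< realized r >].
  by exists 0%N; apply/asboolP; exists 0%N, 0; split=> [[]//|]; rewrite mxrank0.
have r_le r : `[< realized r >] -> (r <= n)%N.
  by move=> /asboolP[m [M [_ <-]]]; exact: rank_leq_col.
case: (ex_maxnP ex_r r_le) => r /asboolP[m [M [Mc Mr]]] rmax.
have [u fu] := choice Mc.
exists m, u => x; have [a0 fx] := fw x; pose a := \row_i a0 i.
have fa : f x = comb a.
  by rewrite fx; apply: eq_bigr => i _; rewrite mxE.
(* Otherwise appending [a] to [M] would raise the rank. *)
have /submxP[d ad] : (a <= M)%MS.
  have : (\rank (col_mx M a) <= \rank M)%N.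
    rewrite Mr; apply: rmax; apply/asboolP; exists (m + 1)%N, (col_mx M a).
    split=> // i; rewrite -[i]fintype.splitK; case: (fintype.split i) => j /=.
      by rewrite rowKu.
    by rewrite rowKd row_id; exists x.
  rewrite -addsmxE => h; apply: submx_trans (addsmxSr M a) _.
  have := mxrank_leqif_sup (addsmxSl M a); move=> -[le_r <-].
  by rewrite eqn_leq le_r.
exists (fun i => d 0 i); rewrite fa ad mulmx_sum_row comb_sum.
by apply: eq_bigr => i _; rewrite fu.
Qed.

Lemma finite_rank_comp_inj (U W W' : lmodType k) (f : {linear U -> W})
    (j : {linear W -> W'}) :
  injective j -> finite_rank (j \o f) -> finite_rank f.
Proof.
move=> jI [n [u fu]]; exists n, u => x; have [a jfx] := fu x; exists a.
apply: jI; rewrite linear_sum [LHS]jfx.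
by apply: eq_bigr => i _; rewrite linearZ.
Qed.

End FiniteRank.

(** * Sorting oriented simplices *)

(** A well-order is a total order: two- and three-element sets have minima. *)
Lemma exists_strict_total_order (X : eqType) : exists lt : rel X,
  [/\ irreflexive lt, transitive lt & forall x y, x != y -> lt x y || lt y x].
Proof.
have [R woR] := wochoice.well_ordering_principle X.
have minR (A : seq X) x : x \in A ->
    exists2 m, m \in A & {in A, forall y, R m y}.
  move=> Ax; have [|m [[Am lbm] _]] := woR [pred y | y \in A].
    by exists x.
  by exists m.
have antiR x y : R x y -> R y x -> x = y.
  move=> Rxy Ryx; have Rxx z : R z z.
    have [m] := minR [:: z] z (mem_head _ _).
    by rewrite inE => /eqP -> /(_ z); apply; rewrite inE.
  have [|m [_ uniqm]] := woR [pred z | z \in [:: x; y]].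
    by exists x; rewrite !inE eqxx.
  have <- : m = x.
    apply: uniqm; split=> [|z]; first by rewrite !inE eqxx.
    by rewrite !inE => /orP[] /eqP ->.
  apply: uniqm; split=> [|z]; first by rewrite !inE eqxx orbT.
  by rewrite !inE => /orP[] /eqP ->.
have totR x y : R x y || R y x.
  have [m] := minR [:: x; y] x (mem_head _ _).
  rewrite !inE => /orP[] /eqP -> Rm; first by rewrite Rm ?inE ?eqxx ?orbT.
  by rewrite (Rm x) ?inE ?eqxx ?orbT.
exists (fun x y => ~~ R y x); split=> [x|y x z|x y xy].
- by have := totR x x; rewrite orbb => ->.
- move=> nyx nzy; apply/negP => Rzx.
  have [m] := minR [:: x; y; z] x (mem_head _ _).
  rewrite !inE => /or3P[] /eqP -> Rm.
  + have Rxz : R x z by apply: Rm; rewrite !inE eqxx !orbT.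
    move: nzy; rewrite -(antiR _ _ Rxz Rzx) => /negP; apply; apply: Rm.
    by rewrite !inE eqxx !orbT.
  + by move: nyx => /negP; apply; apply: Rm; rewrite !inE eqxx.
  + by move: nzy => /negP; apply; apply: Rm; rewrite !inE eqxx !orbT.
- rewrite -negb_and; apply/negP => /andP[Ryx Rxy].
  by move: xy; rewrite (antiR _ _ Rxy Ryx) eqxx.
Qed.

Section Sorting.
Variables (k : fieldType) (X : choiceType).
Local Notation free := {freeg (seq X) / k}.
Local Notation oriented := (span (@orientation_rel k X)).

Variable lt : rel X.
Hypotheses (ltxx : irreflexive lt) (lt_trans : transitive lt).
Hypothesis lt_total : forall x y, x != y -> lt x y || lt y x.

(** Insertion of [x] into an increasing sequence: each vertex that [x] passes
    costs a sign, and a vertex equal to [x] gives the degenerate simplex [0]. *)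
Fixpoint insert_seq (x : X) (s : seq X) : free :=
  if s is y :: s' then
    if x == y then 0
    else if lt x y then << x :: s >>
    else - free_cons k y (insert_seq x s')
  else << [:: x] >>.

Definition insert (x : X) : {linear free -> free} := fglift (insert_seq x).

Fixpoint normalize_seq (s : seq X) : free :=
  if s is x :: s' then insert x (normalize_seq s') else << [::] >>.

Definition normalize : {linear free -> free} := fglift normalize_seq.

Let insertP x a u v : insert x (a *: u + v) = a *: insert x u + insert x v.
Proof. exact: linearP. Qed.

Let normalizeP a u v : normalize (a *: u + v) = a *: normalize u + normalize v.
Proof. exact: linearP. Qed.

Let consP (x : X) a u v :
  free_cons k x (a *: u + v) = a *: free_cons k x u + free_cons k x v.
Proof. exact: linearP. Qed.

Lemma insertE x s : insert x << s >> = insert_seq x s.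
Proof. exact: fglift1. Qed.

Lemma normalizeE s : normalize << s >> = normalize_seq s.
Proof. exact: fglift1. Qed.

Lemma normalize_cons x s :
  normalize << x :: s >> = insert x (normalize << s >>).
Proof. by rewrite !normalizeE. Qed.

Lemma insert_cons_eq x u : insert x (free_cons k x u) = 0.
Proof.
elim/free_ind: u => [|a s u IH]; first by rewrite !linear0.
by rewrite !(insertP, consP) IH free_cons_seq insertE /= eqxx scaler0 addr0.
Qed.

Lemma insert_cons_lt x y u : lt x y ->
  insert x (free_cons k y u) = free_cons k x (free_cons k y u).
Proof.
move=> xy; have xNy : x != y by apply: contraTneq xy => ->; rewrite ltxx.
elim/free_ind: u => [|a s u IH]; first by rewrite !linear0.
rewrite !(insertP, consP) IH !free_cons_seq insertE /=.
by rewrite (negbTE xNy) xy.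
Qed.

Lemma insert_cons_gt x y u : lt y x ->
  insert x (free_cons k y u) = - free_cons k y (insert x u).
Proof.
move=> yx; have xNy : x != y by apply: contraTneq yx => ->; rewrite ltxx.
have xy : lt x y = false.
  by apply/negP => xy; have := lt_trans xy yx; rewrite ltxx.
elim/free_ind: u => [|a s u IH]; first by rewrite !linear0.
rewrite !(insertP, consP) opprD -scalerN IH free_cons_seq.
by rewrite !insertE /= (negbTE xNy) xy.
Qed.

Lemma insert_insert x u : insert x (insert x u) = 0.
Proof.
elim/free_ind: u => [|a s u IH]; first by rewrite !linear0.
rewrite !(insertP, consP) IH addr0; suff -> : insert x (insert x << s >>) = 0.
  by rewrite scaler0.
elim: s {a u IH} => [|y s IH].
  by rewrite [insert x << [::] >>]insertE /= -free_cons_seq insert_cons_eq.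
rewrite -!free_cons_seq; have [<-|] := eqVneq x y.
  by rewrite insert_cons_eq linear0.
move=> /lt_total/orP[xy|yx].
  by rewrite (insert_cons_lt _ xy) insert_cons_eq.
by rewrite (insert_cons_gt _ yx) linearN (insert_cons_gt _ yx) opprK IH linear0.
Qed.

(** Anticommutation is the source of antisymmetry in [normalize].  It holds on
    all sequences, increasing or not, because a vertex smaller than both [x] and
    [y] is passed by both, so that induction on the sequence applies. *)
Lemma insertC x y u : insert x (insert y u) = - insert y (insert x u).
Proof.
wlog xy : x y u / lt x y => [h|].
  have [<-|] := eqVneq x y; first by rewrite insert_insert oppr0.
  by move=> /lt_total/orP[/h //|/h ->]; rewrite opprK.
elim/free_ind: u => [|a s u IH]; first by rewrite !linear0.
rewrite !insertP opprD -scalerN IH; congr (_ *: _ + _).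
elim: s {a u IH} => [|z s IH].
  have insert_nil z : insert z << [::] >> = free_cons k z << [::] >>.
    by rewrite insertE free_cons_seq.
  by rewrite !insert_nil insert_cons_lt// insert_cons_gt// opprK insert_nil.
rewrite -!free_cons_seq.
have [<-|/lt_total/orP[xz|zx]] := eqVneq x z.
- rewrite insert_cons_eq linear0 oppr0 insert_cons_gt// linearN.
  by rewrite insert_cons_eq oppr0.
- rewrite (insert_cons_lt _ xz) (insert_cons_gt _ xy) opprK.
  have [<-|/lt_total/orP[yz|zy]] := eqVneq y z.
  + by rewrite !insert_cons_eq !linear0.
  + by rewrite (insert_cons_lt _ yz) (insert_cons_lt _ xy).
  + by rewrite (insert_cons_gt _ zy) !linearN (insert_cons_lt _ xz).
- have zy := lt_trans zx xy.
  rewrite !insert_cons_gt// !linearN !insert_cons_gt// !opprK IH.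
  by rewrite linearN.
Qed.

(** Exchanging adjacent vertices exchanges two successive insertions, which
    anticommute; repeating a vertex repeats an insertion, whose square is [0]. *)
Lemma normalize_oriented u : in_submod oriented u -> normalize u = 0.
Proof.
apply: (span_ind (P := fun u => normalize u = 0)) => [|a v w nv nw|{}u].
- exact: linear0.
- by rewrite normalizeP nv nw scaler0 addr0.
- case=> [[s1 [x [y [s2 ->]]]]|[s1 [x [s2 ->]]]].
  elim: s1 => [|z s1 IH]; rewrite linearD.
    by rewrite !normalize_cons insertC addNr.
  by rewrite 2!normalize_cons -linearD -linearD IH linear0.
elim: s1 => [|z s1 IH]; rewrite /= normalize_cons.
  by rewrite normalize_cons insert_insert.
by rewrite IH linear0.
Qed.

Lemma insert_sorted x s : path lt x s -> insert x << s >> = << x :: s >>.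
Proof.
rewrite insertE; case: s => [//|y s] /= /andP[xy _]; rewrite xy.
by case: eqVneq xy => // ->; rewrite ltxx.
Qed.

Lemma normalize_sorted s : sorted lt s -> normalize << s >> = << s >>.
Proof.
elim: s => [_|x s IH /= xs]; first exact: normalizeE.
by rewrite normalize_cons IH ?(path_sorted xs)// insert_sorted.
Qed.

(** The scalar [c] is a sign, or [0] when [x] is already in [s]. *)
Lemma insert_sortedP x s : sorted lt s -> exists (c : k) t,
  [/\ sorted lt t, t =i x :: s & insert x << s >> = c *: << t >>].
Proof.
elim: s => [_|y s IH ys].
  by exists 1, [:: x]; split=> //; rewrite scale1r insertE.
have [->|/lt_total/orP[xy|yx]] := eqVneq x y.
- exists 0, (y :: s); split=> // [z|].
    by rewrite !inE orbA orbb.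
  by rewrite -free_cons_seq insert_cons_eq scale0r.
- exists 1, [:: x, y & s]; split=> //; first by rewrite /= xy.
  by rewrite -free_cons_seq insert_cons_lt// scale1r !free_cons_seq.
- move: ys; rewrite /= (path_sortedE lt_trans) => /andP[ys ss].
  have [c [t [st ts xst]]] := IH ss.
  exists (- c), (y :: t); split.
  + rewrite /= (path_sortedE lt_trans) st andbT; apply/allP => z.
    by rewrite ts inE => /orP[/eqP -> //|]; exact: (allP ys).
  + by move=> z; rewrite !inE ts inE orbCA.
  + by rewrite -!free_cons_seq insert_cons_gt// xst linearZ scaleNr.
Qed.

Lemma normalize_seqP (s : seq X) : exists (c : k) t,
  [/\ sorted lt t, t =i s & normalize << s >> = c *: << t >>].
Proof.
elim: s => [|x s [c [t [st ts st']]]].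
  by exists 1, [::]; split=> //; rewrite scale1r normalize_sorted.
have [c' [t' [st'' ts' xt]]] := insert_sortedP x st.
exists (c * c'), t'; split=> // [z|]; first by rewrite ts' !inE ts.
by rewrite normalize_cons st' linearZZ xt scalerA.
Qed.

(** Moving [x] from the front past a smaller vertex is one application of the
    exchange relation. *)
Lemma insert_equiv x u : in_submod oriented (free_cons k x u - insert x u).
Proof.
elim/free_ind: u => [|a s u IH].
  by rewrite !linear0 addr0; exact: in_submod0.
rewrite !(insertP, consP, normalizeP) opprD addrACA -scalerBr.
apply: in_submodP => //.
elim: s {a u IH} => [|y s IH]; rewrite free_cons_seq.
  by rewrite insertE subrr; exact: in_submod0.
rewrite -[<< y :: s >>]free_cons_seq.
have [<-|/lt_total/orP[xy|yx]] := eqVneq x y.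
- rewrite insert_cons_eq subr0; apply: span_sub; right.
  by exists [::], x, s.
- rewrite insert_cons_lt// !free_cons_seq subrr; exact: in_submod0.
- rewrite insert_cons_gt// opprK.
  have -> : << [:: x, y & s] >> + free_cons k y (insert x << s >>) =
      (<< [:: x, y & s] >> + << [:: y, x & s] >>)
      - free_cons k y (free_cons k x << s >> - insert x << s >>).
    by rewrite linearB !free_cons_seq opprB addrACA subrr addr0.
  apply: in_submodB; last exact: free_cons_rel.
  by apply: span_sub; left; exists [::], x, y, s.
Qed.

Lemma normalize_equiv u : in_submod oriented (u - normalize u).
Proof.
elim/free_ind: u => [|a s u IH].
  by rewrite !linear0 addr0; exact: in_submod0.
rewrite !(insertP, consP, normalizeP) opprD addrACA -scalerBr.
apply: in_submodP => //.
elim: s {a u IH} => [|x s IH].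
  by rewrite normalize_sorted// subrr; exact: in_submod0.
rewrite normalize_cons -free_cons_seq.
have -> : free_cons k x << s >> - insert x (normalize << s >>) =
    1 *: free_cons k x (<< s >> - normalize << s >>) +
    (free_cons k x (normalize << s >>) - insert x (normalize << s >>)).
  by rewrite scale1r linearB addrA subrK.
by apply: in_submodP; [exact: free_cons_rel|exact: insert_equiv].
Qed.

End Sorting.

(** * The prism operator *)

(** The additive bookkeeping of the inductive step of the homotopy formula. *)
Fact prism_cancel (V : zmodType) (a b c g p e v : V) :
  g + e = b - v -> a - (b - c) - (p - g) + (p - (c - e)) = a - v.
Proof.
move=> gebv; rewrite !opprB (addrA _ p) (addrA _ g) subrK.
rewrite (addrA _ e) -(addrA _ g) gebv.
by rewrite -(addrA a) (addrA _ b) subrK -(addrA a) (addrAC c) subrr add0r.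
Qed.

Section Prism.
Variables (k : fieldType) (X : choiceType) (f : X -> X).
Local Notation free := {freeg (seq X) / k}.
Local Notation cons := (free_cons k).
Local Notation d := (free_boundary k X).

Definition free_map : {linear free -> free} :=
  fglift (fun s => << map f s >> : free).

(** Recursive form of the alternating sum of the sequences
    [v_0, ..., v_i, f v_i, ..., f v_n]. *)
Fixpoint prism_seq (s : seq X) : free :=
  if s is x :: s' then
    << [:: x, f x & map f s'] >> - cons x (prism_seq s')
  else 0.

Definition prism : {linear free -> free} := fglift prism_seq.

Let free_mapP a u v : free_map (a *: u + v) = a *: free_map u + free_map v.
Proof. exact: linearP. Qed.

Let prismP a u v : prism (a *: u + v) = a *: prism u + prism v.
Proof. exact: linearP. Qed.

Let consP (x : X) a u v : cons x (a *: u + v) = a *: cons x u + cons x v.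
Proof. exact: linearP. Qed.

Let dP a u v : d (a *: u + v) = a *: d u + d v.
Proof. exact: linearP. Qed.

Lemma free_map_seq s : free_map << s >> = << map f s >>.
Proof. exact: fglift1. Qed.

Lemma prismE s : prism << s >> = prism_seq s.
Proof. exact: fglift1. Qed.

Lemma free_map_cons x u : free_map (cons x u) = cons (f x) (free_map u).
Proof.
elim/free_ind: u => [|a s u IH]; first by rewrite !linear0.
by rewrite !(consP, free_mapP) IH free_cons_seq !free_map_seq free_cons_seq.
Qed.

Lemma free_map_boundary u : d (free_map u) = free_map (d u).
Proof.
elim/free_ind: u => [|a s u IH]; first by rewrite !linear0.
rewrite !(free_mapP, dP) IH; congr (_ *: _ + _).
elim: s {a u IH} => [|x s IH].
  by rewrite free_map_seq !free_boundary_nil linear0.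
rewrite -free_cons_seq free_map_cons !free_boundary_cons IH.
by rewrite (linearB free_map) free_map_cons.
Qed.

Lemma prism_cons x u :
  prism (cons x u) = cons x (cons (f x) (free_map u)) - cons x (prism u).
Proof.
elim/free_ind: u => [|a s u IH]; first by rewrite !linear0 addr0.
rewrite !(consP, prismP, free_mapP) IH opprD addrACA -scalerBr.
congr (_ *: _ + _).
by rewrite free_cons_seq !prismE free_map_seq !free_cons_seq.
Qed.

(** Valid on the empty sequence too, where both sides vanish because [f] maps
    it to itself; there is no augmentation term. *)
Lemma prism_homotopy u : d (prism u) + prism (d u) = free_map u - u.
Proof.
elim/free_ind: u => [|a s u IH]; first by rewrite !linear0 !addr0.
rewrite !(dP, prismP, free_mapP) opprD [LHS]addrACA [RHS]addrACA.
rewrite -scalerBr -scalerDr IH; congr (_ *: _ + _).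
elim: s {a u IH} => [|x s IH].
  rewrite free_boundary_nil (linear0 prism) prismE free_map_seq.
  by rewrite subrr addr0 linear0.
rewrite -free_cons_seq free_boundary_cons prism_cons free_map_cons.
set u := << s >> in IH *.
rewrite (linearB d) (linearB prism) !free_boundary_cons prism_cons.
rewrite free_map_boundary (linearB (cons x)).
have : cons x (d (prism u)) + cons x (prism (d u)) =
    cons x (free_map u) - cons x u.
  by rewrite -linearD IH linearB.
exact: prism_cancel.
Qed.

End Prism.

(** * Contiguous self-maps and homology *)

Section Contiguity.
Variables (k : fieldType) (X : choiceType).
Implicit Types K L : simplicial_complex X.
Local Notation free := {freeg (seq X) / k}.
Local Notation oriented := (span (@orientation_rel k X)).
Local Notation d := (free_boundary k X).
Local Notation proj := (quot_proj (chain_rel k X)).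

(** Combinations of sequences before the orientation relations are imposed,
    where the prism operator makes sense. *)
Definition free_on (P : set (seq X)) : submod free :=
  span [set u | exists2 s, P s & u = << s >>].

Definition seqs_of K : set (seq X) :=
  [set s | simplices K [fset x | x in s]%fset].

Lemma free_on_seq (P : set (seq X)) s : P s -> in_submod (free_on P) << s >>.
Proof. by move=> Ps; apply: span_sub; exists s. Qed.

Lemma complex_chains_proj K u :
  in_submod (free_on (seqs_of K)) u -> in_submod (complex_chains k K) (proj u).
Proof.
by apply: span_linear => _ [s Ks ->]; apply: span_sub; exists s.
Qed.

Lemma chain_rel_oriented u : in_submod oriented u -> in_submod (chain_rel k X) u.
Proof. by apply: span_min => v rv; apply: span_sub; left. Qed.

Variable lt : rel X.
Hypotheses (ltxx : irreflexive lt) (lt_trans : transitive lt).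
Hypothesis lt_total : forall x y, x != y -> lt x y || lt y x.

Lemma osimplex_sorted (s : seq X) : exists (c : k) t,
  [/\ sorted lt t, t =i s & osimplex k s = c *: osimplex k t].
Proof.
have [c [t [st ts st']]] := normalize_seqP k ltxx lt_trans lt_total s.
exists c, t; split=> //; rewrite -linearZ -st'; apply/quot_projP.
exact/chain_rel_oriented/normalize_equiv.
Qed.

Lemma complex_chains_sorted K z : in_submod (complex_chains k K) z ->
  exists2 u, in_submod (free_on [set s | sorted lt s /\ seqs_of K s]) u
    & z = proj u.
Proof.
set S := free_on _ => Kz.
suff /submod_setE : in_submod (image_submod proj S) z by [].
apply: span_min Kz => _ [s Ks ->].
have [c [t [st ts ->]]] := osimplex_sorted s.
apply: in_submodZ; apply/submod_setE; exists << t >> => //.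
apply: free_on_seq; split=> //; rewrite /seqs_of/=.
suff -> : [fset x | x in t]%fset = [fset x | x in s]%fset by [].
by apply/fsetP => x; rewrite !inE ts.
Qed.

(** Faces of an increasing sequence are subsequences of it. *)
Lemma boundary_sorted u : in_submod (free_on [set s | sorted lt s]) u ->
  in_submod (free_on [set s | sorted lt s]) (d u).
Proof.
apply: span_linear => _ [s ss ->]; rewrite [d _]fglift1.
apply: rpred_sum => i _; apply: rpredZ; apply: free_on_seq.
apply: (subseq_sorted lt_trans) ss.
rewrite -[X in subseq _ X](cat_take_drop i s); apply: cat_subseq => //.
by rewrite -add1n -drop_drop; exact: drop_subseq.
Qed.

(** [normalize] fixes [u] and kills every relation except the one that makes the
    empty sequence zero. *)
Lemma chain_rel_sorted u : in_submod (free_on [set s | sorted lt s]) u ->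
  in_submod (chain_rel k X) u -> in_submod (free_on [set [::]]) u.
Proof.
move=> su ru; have <- : normalize k lt u = u.
  apply: (span_ind (P := fun v => normalize k lt v = v)) su.
  - exact: linear0.
  - by move=> a v w nv nw; rewrite linearP nv nw.
  - by move=> _ [s ss ->]; exact: normalize_sorted.
apply: span_linear ru => v [rv|->].
  rewrite (normalize_oriented ltxx lt_trans lt_total); last exact: span_sub.
  exact: in_submod0.
by rewrite normalize_sorted//; exact: free_on_seq.
Qed.

Section SelfMap.
Variables (K L : simplicial_complex X) (f : X -> X).
Hypothesis contiguous : forall s, simplices K s ->
  simplices L (s `|` [fset f x | x in s])%fset.

Lemma prism_seqs s t : seqs_of K s -> t != [::] ->
  {subset t <= s ++ map f s} -> seqs_of L t.
Proof.
move=> Ks t0 ts; apply: (simplices_face (contiguous Ks)).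
  apply/fsubsetP => x; rewrite !inE /= => /ts; rewrite mem_cat.
  move=> /orP[->//|/mapP[y ys ->]]; apply/orP; right.
  by apply/imfsetP; exists y => //; rewrite !inE.
by case: t t0 {ts} => // x t _; apply/fset0Pn; exists x; rewrite !inE eqxx.
Qed.

Lemma prism_complex u : in_submod (free_on (seqs_of K)) u ->
  in_submod (free_on (seqs_of L)) (prism k f u).
Proof.
apply: span_linear => _ [s Ks ->].
pose T s := [set t : seq X | t != [::] /\ {subset t <= s ++ map f s}].
have : in_submod (free_on (T s)) (prism k f << s >>).
  rewrite prismE; elim: s {Ks} => [|x s IH] /=; first exact: in_submod0.
  apply: in_submodB.
    apply: free_on_seq; split=> // y; rewrite !(inE, mem_cat).
    by move=> /or3P[] -> ; rewrite ?orbT.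
  apply: span_linear IH => _ [t [t0 ts] ->]; rewrite free_cons_seq.
  apply: free_on_seq; split=> // y; rewrite !(inE, mem_cat).
  move=> /predU1P[->|/ts]; first by rewrite eqxx.
  by rewrite mem_cat => /orP[] ->; rewrite ?orbT.
apply: span_min => _ [t [t0 ts] ->]; apply: free_on_seq.
exact: prism_seqs ts.
Qed.

(** The boundary of a sorted lift of a cycle is sorted and projects to [0], so
    it is a multiple of the empty sequence, which the prism operator kills. *)
Lemma cycle_homologous z : in_submod (cycles k K) z ->
  exists2 u, in_submod (free_on (range (map f))) u
    & in_submod (boundaries k L) (z - proj u).
Proof.
move=> /submod_setE[/complex_chains_sorted[u su ->] zu].
have ss : in_submod (free_on [set s | sorted lt s]) u.
  by apply: span_min su => _ [s [ss _] ->]; exact: free_on_seq.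
have sK : in_submod (free_on (seqs_of K)) u.
  by apply: span_min su => _ [s [_ Ks] ->]; exact: free_on_seq.
have pdu : prism k f (d u) = 0.
  have : in_submod (free_on [set [::]]) (d u).
    apply: chain_rel_sorted; first exact: boundary_sorted.
    rewrite -[d u]subr0; apply/quot_projP.
    by rewrite -boundaryE zu linear0.
  apply: (span_ind (P := fun v => prism k f v = 0)).
  - exact: linear0.
  - by move=> a v w pv pw; rewrite linearP pv pw scaler0 addr0.
  - by move=> _ [_ -> ->]; rewrite prismE.
exists (free_map k f u).
  apply: span_linear sK => _ [s _ ->]; rewrite free_map_seq.
  by apply: free_on_seq; exists s.
rewrite -opprB -scaleN1r; apply: in_submodZ; apply/submod_setE.
exists (proj (prism k f u)); first exact/complex_chains_proj/prism_complex.
by rewrite boundaryE -linearB -prism_homotopy pdu addr0.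
Qed.

End SelfMap.

(** An increasing sequence with entries in [F] is determined by its set of
    entries, hence it is a mask of the increasing enumeration [l] of [F]. *)
Lemma chains_on_finite (F : seq X) : exists n (w : 'I_n -> chains k X),
  forall u, in_submod (free_on [set s | {subset s <= F}]) u ->
  in_submod (span (range w)) (proj u).
Proof.
have [_ [l [sl lF _]]] := osimplex_sorted F.
pose m (i : 'I_#|{: (size l).-tuple bool}|) := enum_val i.
exists #|{: (size l).-tuple bool}|, (fun i => osimplex k (mask (m i) l)) => u.
apply: span_linear => _ [s sF ->].
have [c [t [st ts st']]] := osimplex_sorted s.
rewrite [X in in_submod _ X](_ : _ = osimplex k s)// st'.
apply: in_submodZ; apply: span_sub.
exists (enum_rank [tuple of map [in t] (in_tuple l)]) => //.
rewrite /m enum_rankK /= -filter_mask; congr osimplex.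
apply: (irr_sorted_eq lt_trans ltxx) => //.
  exact: sorted_filter.
by move=> x; rewrite mem_filter lF andb_idr// ts => /sF.
Qed.

End Contiguity.

(** Modulo boundaries of [L], each cycle of [K] is a chain with vertices in the
    finite set [F].  The simplices spanning those chains are not cycles, so they
    have no class in the homology of [L]; the rank is therefore computed after
    embedding this homology in the quotient of all chains by the boundaries. *)
Lemma finite_rank_homology_map (k : fieldType) (X : choiceType)
    (K L : simplicial_complex X) (KL : subcomplex K L) (f : X -> X) (F : seq X) :
  (forall x, f x \in F) ->
  (forall s, simplices K s -> simplices L (s `|` [fset f x | x in s])%fset) ->
  finite_rank (homology_map k KL).
Proof.
move=> fF contiguous.
have [lt [ltxx lt_trans lt_total]] := exists_strict_total_order X.
pose B : {linear chains k X -> quotmod (boundaries k L)} :=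
  quot_proj (boundaries k L).
have B0 z : in_submod (preimage_submod (cycle_inj k L) (boundaries k L)) z ->
    (B \o cycle_inj k L) z = 0.
  move=> /submod_setE Lz; rewrite -[RHS](linear0 B); apply/quot_projP.
  by rewrite subr0.
pose j : {linear homology k L -> quotmod (boundaries k L)} := quot_lift B0.
have jE z : j (homology_class z) = B (val z) by exact: quot_liftE.
have jI : injective j.
  move=> x y; rewrite -[x]quot_proj_repr -[y]quot_proj_repr.
  rewrite -!/(homology_class _) !jE => /quot_projP h; apply/quot_projP.
  by apply/submod_setE; rewrite /mkset (linearB (cycle_inj k L)).
have [n [w wP]] := chains_on_finite k ltxx lt_trans lt_total F.
apply: (finite_rank_comp_inj jI).
apply: (@finite_rank_codomain _ _ _ _ n (B \o w)).
move=> x; rewrite -[x]quot_proj_repr -/(homology_class (repr x)).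
move: (repr x) => z.
have [u uF zu] := cycle_homologous ltxx lt_trans lt_total contiguous (valP z).
have [a wa] : exists a : 'I_n -> k,
    quot_proj (chain_rel k X) u = \sum_(i < n) a i *: w i.
  apply: span_finite; apply: wP; apply: span_min uF => _ [_ [s _ <-] ->].
  by apply: free_on_seq => _ /mapP[y _ ->].
exists a; rewrite [LHS](_ : _ = B (val z)).
  have -> : B (val z) = B (quot_proj (chain_rel k X) u) by exact/quot_projP.
  by rewrite wa (linear_sum B); apply: eq_bigr => i _; exact: linearZ.
rewrite [LHS](_ : _ = j (homology_map k KL (homology_class z)))//.
by rewrite homology_mapE jE.
Qed.

(** * Vietoris-Rips and Cech filtrations *)

Section TotallyBounded.
Variables (R : realType) (X : metricType R).

Lemma net_projection (e : R) : is_totally_bounded X -> 0 < e ->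
  exists (f : X -> X) (F : {fset X}), forall x, f x \in F /\ mdist x (f x) < e.
Proof.
move=> tb e0; have [F Fe] := tb _ e0.
have /choice[f fP] x : exists y, y \in F /\ mdist x y < e.
  by have [y] := Fe x; exists y.
by exists f, F.
Qed.

(** Every vertex of the union is within [e] of a vertex of [s], so distances grow
    by at most [2 e]. *)
Lemma rips_contiguous (f : X -> X) (a e : R) s :
  (forall x, mdist x (f x) <= e) -> 0 <= e -> simplices (rips X a) s ->
  simplices (rips X (a + (e + e))) (s `|` [fset f x | x in s])%fset.
Proof.
move=> fe e0 [/fset0Pn[x0 sx0] sa]; split.
  by apply/fset0Pn; exists x0; rewrite inE sx0.
have near x : x \in (s `|` [fset f x | x in s])%fset ->
    exists2 y, y \in s & mdist x y <= e.
  rewrite inE => /orP[xs|/imfsetP[y /= ys ->]].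
    by exists x => //; rewrite mdistxx.
  by exists y => //; rewrite metric_sym.
move=> x y /near[x' sx' xx'] /near[y' sy' yy'].
apply: le_trans (metric_triangle x x' y) _; rewrite addrCA lerD//.
apply: le_trans (metric_triangle x' y' y) _; rewrite lerD ?sa//.
by rewrite metric_sym.
Qed.

(** The common point [c] of the balls of radius [a] around the vertices of [s]
    still serves at radius [a + e]. *)
Lemma cech_contiguous (f : X -> X) (a e : R) s :
  (forall x, mdist x (f x) <= e) -> 0 <= e -> simplices (cech X a) s ->
  simplices (cech X (a + e)) (s `|` [fset f x | x in s])%fset.
Proof.
move=> fe e0 [/fset0Pn[x0 sx0] [c sc]]; split.
  by apply/fset0Pn; exists x0; rewrite inE sx0.
exists c => x /=; rewrite inE => /orP[xs|/imfsetP[y /= ys ->]].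
  by apply: le_trans (sc x xs) _; rewrite lerDl.
apply: le_trans (metric_triangle (f y) y c) _; rewrite addrC lerD//.
  exact: sc.
by rewrite metric_sym.
Qed.

End TotallyBounded.

Theorem proposition5p1 (k : fieldType) (R : realType) (X : metricType R)
  (tbX : is_totally_bounded X) :
  q_tame (persistent_homology k (rips_filtration X)) /\
  q_tame (persistent_homology k (cech_filtration X)).
Proof.
split=> a b ab.
  have e0 : 0 < (b - a) / 2 by rewrite divr_gt0// subr_gt0.
  have [f [F fF]] := net_projection tbX e0.
  apply: (@finite_rank_homology_map _ _ _ _ _ f F) => [x|s sa].
    by have [] := fF x.
  have -> : b = a + ((b - a) / 2 + (b - a) / 2) by rewrite -splitr addrC subrK.
  apply: rips_contiguous => // [x|]; last exact: ltW.
  by have [_ /ltW] := fF x.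
have e0 : 0 < b - a by rewrite subr_gt0.
have [f [F fF]] := net_projection tbX e0.
apply: (@finite_rank_homology_map _ _ _ _ _ f F) => [x|s sa].
  by have [] := fF x.
have -> : b = a + (b - a) by rewrite addrC subrK.
apply: cech_contiguous => // [x|]; last exact: ltW.
by have [_ /ltW] := fF x.
Qed.
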